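(* Let $T=\sum_{j=1}^{k}Q_jD^j=\sum_{j=1}^{k}\big(\sum_{i=0}^{\deg Q_j}\alpha_{j,i}z^i\big)D^j$ be a degenerate exactly-solvable operator of order $k$. Then for any real $\gamma<b$ we have $$\lim_{n\to\infty}\frac{r_n}{n^{\gamma}}=\infty,$$ where $$b:=\min_{j\in[1,k-1]}^{+}\bigg(\frac{k-j}{k-j+\deg Q_j-\deg Q_k}\bigg),$$ and where the notation $\min^{+}$ means that the minimum is taken only over those $j$ for which $k-j+\deg Q_j-\deg Q_k$ is positive.
   Context: Here $D=d/dz$, and $[a,b]$ as a range for the index $j$ denotes integers. A degenerate exactly-solvable operator of order $k$ is a linear differential operator $T=\sum_{j=1}^{k}Q_jD^j$ with polynomial coefficients $Q_j\in\mathbb{C}[z]$, $Q_k\not\equiv 0$, such that $\deg Q_j\leq j$ for all $j$, with equality for at least one $j$, and $\deg Q_k<k$. For all sufficiently large integers $n$ there exist a unique constant $\lambda_n$ and a unique monic polynomial $p_n$ of degree $n$ with $T(p_n)=\lambda_n p_n$. For such $n$, $r_n=\max\{|z|:p_n(z)=0\}$. Minima over $j$ are taken only over those $j$ for which $Q_j$ is not identically zero. *)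

(* Defs.v *)
From HB Require Import structures.
From mathcomp Require Import all_boot all_order all_algebra.
From mathcomp Require Import finmap.
From mathcomp Require Import all_classical all_reals all_analysis.
From mathcomp Require Import complex.

Set Implicit Arguments.
Unset Strict Implicit.
Unset Printing Implicit Defensive.

Import Order.TTheory GRing.Theory Num.Theory.
Import numFieldNormedType.Exports.

Local Open Scope classical_set_scope.
Local Open Scope ring_scope.
Local Open Scope complex_scope.

(* The complex numbers are [R[i]] for an arbitrary [R : realType].  An operator
   of order [k] is given by its coefficients [Q : nat -> {poly R[i]}], of which
   only [Q 1], ..., [Q k] matter. *)

Definition diffop (R : realType) (k : nat) (Q : nat -> {poly R[i]})
    (p : {poly R[i]}) : {poly R[i]} :=
  \sum_(1 <= j < k.+1) Q j * p^`(j).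

(* [size q] is [deg q + 1] for [q != 0], and [size 0 = 0], so that the zero
   polynomial satisfies every degree upper bound and no degree equality. *)
Definition degenerate_exactly_solvable (R : realType) (k : nat)
    (Q : nat -> {poly R[i]}) : Prop :=
  [/\ Q k != 0,
      (forall j : nat, (1 <= j <= k)%N -> (size (Q j) <= j.+1)%N),
      (exists2 j : nat, (1 <= j <= k)%N & size (Q j) = j.+1)
    & (size (Q k) < k.+1)%N].

Definition is_monic_eigenpoly (R : realType) (k : nat) (Q : nat -> {poly R[i]})
    (n : nat) (p : {poly R[i]}) : Prop :=
  [/\ p \is monic, size p = n.+1
    & exists lambda : R[i], diffop k Q p = lambda *: p].

(* The polynomial p_n.  A monic eigenpolynomial of degree [n] exists and is
   unique for all large [n]; for the other [n] the value is immaterial (it is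
   [0] when there is none). *)
Definition es_eigenpoly (R : realType) (k : nat) (Q : nat -> {poly R[i]})
    (n : nat) : {poly R[i]} :=
  xget 0 [set p | is_monic_eigenpoly k Q n p].

(* The zero set of a nonzero polynomial is finite, so that [fset_set] enumerates
   it; the default value [0] of the maximum is only used when there are no
   zeros. *)
Definition root_radius (R : realType) (p : {poly R[i]}) : R :=
  \big[Num.max/0]_(z <- fset_set [set z : R[i] | root p z]) Normc.normc z.

Definition pdeg (R : realType) (q : {poly R[i]}) : nat := (size q).-1.

Definition min_denom (R : realType) (k : nat) (Q : nat -> {poly R[i]})
    (j : nat) : int :=
  k%:Z - j%:Z + (pdeg (Q j))%:Z - (pdeg (Q k))%:Z.

(* The minimum ranges over a nonempty set of indices when the operator is
   degenerate exactly-solvable: any [j] with [deg (Q j) = j] qualifies, as then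
   the denominator is [k - deg (Q k) > 0].  The neutral element [+oo] is thus
   never the value. *)
Definition min_exponent (R : realType) (k : nat) (Q : nat -> {poly R[i]}) :
    \bar R :=
  \big[Order.min/+oo%E]_(1 <= j < k | (Q j != 0) && (0 < min_denom k Q j))
    ((k%:R - j%:R) / (min_denom k Q j)%:~R : R)%:E.

(* Main.v *)
(* If all zeros of q lie in the open disc |w| < |z|, then Re (z q'(z)/q(z)), the
   sum of the Re (z/(z-w)), is at least deg q / 2.  Hence the zeros of every
   derivative of p = p_n stay in any disc about 0 containing those of p
   (Gauss-Lucas), and outside it |z^j p^(j)(z)| <= (4/n)^(k-j) |z^k p^(k)(z)| as
   soon as n >= 2k.  Let x = n^c with max(gamma, 0) < c < b, and suppose
   r_n < x.  Dividing the equation T p = lambda_n p at x by p^(k)(x), the term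
   Q_j p^(j), and also the contribution of alpha_{j,j} to lambda_n, is at most
   a constant times x^(deg Q_j + k - j) n^(-(k-j)), which is o(x^(deg Q_k))
   because c < b.  This contradicts |Q_k(x)| ~ x^(deg Q_k), so r_n >= n^c. *)
Require Import Defs.
From HB Require Import structures.
From mathcomp Require Import all_boot all_order all_algebra.
From mathcomp Require Import all_classical all_reals all_analysis.
From mathcomp Require Import complex.
From mathcomp Require Import zify ring lra.

Set Implicit Arguments.
Unset Strict Implicit.
Unset Printing Implicit Defensive.

Import Order.TTheory GRing.Theory Num.Theory.
Import numFieldNormedType.Exports.

Local Open Scope classical_set_scope.
Local Open Scope ring_scope.
Local Open Scope complex_scope.

(** * The modulus on [R[i]] *)

Local Notation normc := Normc.normc.

Lemma Re_le_normc (R : rcfType) (z : R[i]) : complex.Re z <= normc z.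
Proof.
case: z => a b /=; apply: le_trans (ler_norm a) _.
by rewrite -sqrtr_sqr ler_wsqrtr // lerDl sqr_ge0.
Qed.

Lemma normc_ge0 (R : rcfType) (z : R[i]) : 0 <= normc z.
Proof. by case: z => a b; exact: sqrtr_ge0. Qed.

Lemma normc_gt0 (R : rcfType) (z : R[i]) : z != 0 -> 0 < normc z.
Proof.
move=> z0; rewrite lt_def normc_ge0 andbT.
by apply: contra_neq z0; exact: Normc.eq0_normc.
Qed.

Lemma normcX (R : rcfType) (z : R[i]) n : normc (z ^+ n) = normc z ^+ n.
Proof.
by elim: n => [|n IH]; rewrite ?expr0 ?Normc.normc1 // !exprS Normc.normcM IH.
Qed.

Lemma normc_real (R : rcfType) (x : R) : 0 <= x -> normc x%:C = x.
Proof. by move=> x0; rewrite /= expr0n addr0 sqrtr_sqr ger0_norm. Qed.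

Lemma normc_nat (R : rcfType) n : normc (n%:R : R[i]) = n%:R.
Proof. by rewrite -(rmorph_nat (real_complex R)) normc_real. Qed.

Lemma normc_sum (R : rcfType) I (s : seq I) (P : pred I) (F : I -> R[i]) :
  normc (\sum_(i <- s | P i) F i) <= \sum_(i <- s | P i) normc (F i).
Proof.
elim/big_rec2: _ => [|i y x _ xy]; first by rewrite Normc.normc0.
by apply: le_trans (le_normcD _ _) _; rewrite lerD2l.
Qed.

(** * Logarithmic derivatives and the zeros of derivatives *)

(** After clearing denominators this rests on 2 Re(z conj(z-w)) - |z-w|^2 = |z|^2 - |w|^2, which is
    positive. *)
Lemma Re_div_subr_ge (R : rcfType) (z w : R[i]) :
  normc w < normc z -> 2^-1 <= complex.Re (z / (z - w)).
Proof.
move=> wz; have zw0 : z - w != 0.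
  by apply: contraTneq wz => /eqP; rewrite subr_eq0 => /eqP ->; rewrite ltxx.
case: z w wz zw0 => [a b] [c d] wz zw0.
have {}wz : c ^+ 2 + d ^+ 2 < a ^+ 2 + b ^+ 2.
  by rewrite ltNge; apply: contraL wz => h; rewrite -leNgt /= ler_wsqrtr.
have s0 : 0 < (a - c) ^+ 2 + (b - d) ^+ 2.
  rewrite lt_def addr_ge0 ?sqr_ge0 // andbT; apply: contraNneq zw0 => /eqP.
  rewrite paddr_eq0 ?sqr_ge0 // !sqrf_eq0 !subr_eq0 => /andP[/eqP -> /eqP ->].
  by [].
have -> : complex.Re ((a +i* b) / ((a +i* b) - (c +i* d))) =
  (a * (a - c) + b * (b - d)) / ((a - c) ^+ 2 + (b - d) ^+ 2).
  by rewrite /=; field; rewrite gt_eqF.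
by rewrite ler_pdivlMr //; nra.
Qed.

(** Each factor X - w adds z/(z-w) to z p'/p, hence at least 1/2 to its real part. *)
Lemma Re_logderiv_prod_ge (R : rcfType) (s : seq R[i]) (z : R[i]) :
  (forall w, w \in s -> normc w < normc z) ->
  let p := \prod_(w <- s) ('X - w%:P) in
  p.[z] != 0 /\ (size s)%:R / 2 <= complex.Re (z * p^`().[z] / p.[z]).
Proof.
elim: s => [|w s IH] ws.
  by rewrite /= big_nil -polyC1 derivC hornerC horner0 oner_neq0 mulr0 !mul0r.
have [|q0 IH2] := IH; first by move=> v vs; apply: ws; rewrite inE vs orbT.
have wz : normc w < normc z by apply: ws; rewrite mem_head.
have zw0 : z - w != 0.
  by apply: contraTneq wz => /eqP; rewrite subr_eq0 => /eqP ->; rewrite ltxx.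
rewrite /= big_cons; set q := \prod_(_ <- _) _ in q0 IH2 *.
rewrite derivM derivXsubC mul1r hornerD !hornerM hornerXsubC; split.
  by rewrite mulf_neq0.
have -> : z * (q.[z] + (z - w) * q^`().[z]) / ((z - w) * q.[z]) =
  z / (z - w) + z * q^`().[z] / q.[z] by field; rewrite q0 zw0.
rewrite raddfD /= -natr1 mulrDl addrC lerD // div1r.
exact: Re_div_subr_ge.
Qed.

(** As [R[i]] is algebraically closed, [p] is a product of linear factors times its leading
    coefficient, which cancels in p'/p; the real part is then bounded by the modulus. *)
Lemma deriv_horner_ge (R : rcfType) (p : {poly R[i]}) (z : R[i]) :
  p != 0 -> (forall w, root p w -> normc w < normc z) ->
  p.[z] != 0 /\
  (size p).-1%:R / 2 * normc p.[z] <= normc z * normc p^`().[z].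
Proof.
move=> p0 pz; have [s ps] := closed_field_poly_normal p.
have l0 : lead_coef p != 0 by rewrite lead_coef_eq0.
have sz : forall w, w \in s -> normc w < normc z.
  by move=> w ws; apply: pz; rewrite ps rootZ // root_prod_XsubC.
have -> : (size p).-1 = size s.
  by rewrite {1}ps size_scale // size_prod_XsubC.
have [q0 hq] := Re_logderiv_prod_ge sz.
rewrite ps derivZ !hornerZ mulf_neq0 //; split=> //.
set q := \prod_(_ <- _) _ in q0 hq *.
rewrite !Normc.normcM mulrCA (mulrCA (normc z)) ler_wpM2l ?normc_ge0 //.
rewrite -ler_pdivlMr ?normc_gt0 // (le_trans hq) //.
by apply: le_trans (Re_le_normc _) _; rewrite !Normc.normcM Normc.normcV.
Qed.

Lemma size_deriv_num (R : numDomainType) (p : {poly R}) :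
  size p^`() = (size p).-1.
Proof.
have [lep1|lt1p] := leqP (size p) 1.
  by rewrite (size1_polyC lep1) derivC size_poly0 size_polyC; case: (_ != 0).
have dp : (size p).-2.+1 = (size p).-1 by lia.
apply: size_poly_eq; rewrite dp mulrn_eq0 negb_or -lead_coefE lead_coef_eq0.
by rewrite -size_poly_gt0 ltnW // -lt0n -dp.
Qed.

(** Gauss-Lucas for discs about 0. If p^(j+1) vanished at w with |w| >= rho, all zeros of p^(j)
    would have modulus below |w|, and [deriv_horner_ge] at w would bound a positive number by 0. *)
Lemma derivn_roots_lt (R : rcfType) (p : {poly R[i]}) (rho : R) (j : nat) :
  (j < size p)%N -> (forall w, root p w -> normc w < rho) ->
  size p^`(j) = (size p - j)%N /\ forall w, root p^`(j) w -> normc w < rho.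
Proof.
elim: j => [|j IH] jp prho; first by rewrite derivn0 subn0.
have [sj rj] := IH (ltnW jp) prho.
have q0 : p^`(j) != 0 by rewrite -size_poly_gt0 sj subn_gt0 ltnW.
rewrite derivnS; split; first by rewrite size_deriv_num sj subnS.
move=> w /rootP qw; rewrite ltNge; apply/negP => rw.
have [] := @deriv_horner_ge _ p^`(j) w q0.
  by move=> v /rj /lt_le_trans; exact.
rewrite qw Normc.normc0 mulr0 sj => qw0; rewrite leNgt mulr_gt0 ?normc_gt0 //.
by rewrite divr_gt0 // ltr0n -subnS subn_gt0.
Qed.

(** Iterates [deriv_horner_ge] from j up to k. For i < k the degree n - i of p^(i) is at least n/2,
    because n >= 2k, so each step gains a factor n/4. *)
Lemma derivn_horner_ge (R : rcfType) (p : {poly R[i]}) (z : R[i])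
    (n k j : nat) :
  size p = n.+1 -> (k.*2 <= n)%N -> (j <= k)%N -> (0 < normc z) ->
  (forall w, root p w -> normc w < normc z) ->
  p^`(j).[z] != 0 /\
  (n%:R / 4) ^+ (k - j) * (normc z ^+ j * normc p^`(j).[z])
    <= normc z ^+ k * normc p^`(k).[z].
Proof.
move=> sp kn jk z0 pz.
have step i : (i <= k)%N -> p^`(i).[z] != 0 /\
    (n - i)%:R / 2 * normc p^`(i).[z] <= normc z * normc p^`(i.+1).[z].
  move=> ik; have ip : (i < size p)%N by rewrite sp; lia.
  have [si ri] := derivn_roots_lt ip pz.
  have := @deriv_horner_ge _ p^`(i) z; rewrite si sp subSn ?derivnS; last lia.
  by apply=> //; rewrite -size_poly_gt0 si subn_gt0.
split; first by have [] := step j jk.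
elim: k jk kn step => [|k IH] jk kn step.
  by move: jk; rewrite leqn0 => /eqP ->; rewrite mul1r.
move: jk; rewrite leq_eqVlt => /orP[/eqP ->|jk]; first by rewrite subnn mul1r.
rewrite subSn // exprS -mulrA.
apply: (@le_trans _ _ (n%:R / 4 * (normc z ^+ k * normc p^`(k).[z]))).
  rewrite ler_wpM2l ?divr_ge0 //; apply: IH => //; first lia.
  by move=> i ik; apply: step; lia.
rewrite exprSr -(mulrA (_ ^+ k)) (mulrCA (_ / _)).
rewrite ler_wpM2l ?exprn_ge0 ?normc_ge0 //.
have [_] := step k (leqnSn k); apply: le_trans.
rewrite ler_wpM2r ?normc_ge0 // ler_pdivrMr // -mulrA.
have -> : 2^-1 * 4 = 2 :> R by field.
rewrite -natrM ler_nat.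
lia.
Qed.

(** * Differences of falling factorials *)

Lemma leq_ffact2l (n m j : nat) : (m <= n)%N -> (m ^_ j <= n ^_ j)%N.
Proof.
by move=> mn; elim: j => // j IH; rewrite !ffactnSr leq_mul ?leq_sub2r.
Qed.

(** The new factors are n - j for n and m - j for m; replacing the latter by the larger n - j only
    shrinks the difference. *)
Lemma leq_ffactB (n m j : nat) : (m <= n)%N ->
  ((n - j) * (n ^_ j - m ^_ j) <= n ^_ j.+1 - m ^_ j.+1)%N.
Proof.
move=> mn; rewrite mulnBr !ffactnSr mulnC leq_sub2l //.
by rewrite mulnC leq_mul2r leq_sub2r ?orbT.
Qed.

Lemma leq_ffactB_mono (n m i j : nat) : (m <= n)%N -> (i <= j <= n)%N ->
  (n ^_ i - m ^_ i <= n ^_ j - m ^_ j)%N.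
Proof.
move=> mn; elim: j => [|j IH] /andP[ij jn]; first by move: ij; case: i.
move: ij; rewrite leq_eqVlt => /orP[/eqP -> //|ij].
apply: leq_trans (leq_ffactB j mn); apply: (@leq_trans (n ^_ j - m ^_ j)).
  by apply: IH; lia.
by rewrite leq_pmull // subn_gt0.
Qed.

(* By leq_ffactB the difference of the top falling factorials exceeds those of
   the lower ones by a factor n - K, so it dominates the sum for n large. *)
Lemma ffact_comb_inj (R : realType) (a : nat -> R[i]) (K : nat) :
  (exists2 j, (0 < j <= K)%N & a j != 0) ->
  exists N, forall n m, (N <= n)%N -> (m < n)%N ->
    \sum_(1 <= j < K.+1) a j * (m ^_ j)%:R !=
    \sum_(1 <= j < K.+1) a j * (n ^_ j)%:R.
Proof.
elim: K => [|K IH] [j /andP[j0 jK] aj]; first by move: (leq_trans j0 jK).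
have [aK|aK] := eqVneq (a K.+1) 0.
  have [|N HN] := IH.
    exists j => //; have : j != K.+1 by apply: contra_neq aj => ->.
    by lia.
  exists N => n m Nn mn; have := HN n m Nn mn.
  by rewrite !(big_nat_recr K.+1) //= aK !mul0r !addr0.
pose A := \sum_(1 <= j < K.+1) normc (a j).
(* For n >= N + K + 1 the gain n - (K + 1) exceeds A / |a_(K+1)|. *)
pose N := (Num.truncn (A / normc (a K.+1))).+1.
exists (N + K.+1)%N => n m Nn mn; apply/eqP => eqs.
pose D i := (n ^_ i - m ^_ i)%N.
have DE i : (n ^_ i)%:R - (m ^_ i)%:R = (D i)%:R :> R[i].
  by rewrite natrB // leq_ffact2l // ltnW.
have DK0 : (0 < D K.+1)%N.
  apply: (@leq_trans (D 1%N)); first by rewrite /D !ffactn1 subn_gt0.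
  by apply: leq_ffactB_mono; lia.
(* If the two sums agreed, the top difference would be balanced by the lower ones. *)
have top : a K.+1 * (D K.+1)%:R = - \sum_(1 <= j < K.+1) a j * (D j)%:R.
  have -> : \sum_(1 <= j < K.+1) a j * (D j)%:R =
      \sum_(1 <= j < K.+1) a j * (n ^_ j)%:R -
      \sum_(1 <= j < K.+1) a j * (m ^_ j)%:R.
    by rewrite -sumrB; apply: eq_bigr => i _; rewrite -DE mulrBr.
  move: eqs; rewrite !(big_nat_recr K.+1) //= -DE mulrBr opprB => /eqP.
  by rewrite -subr_eq => /eqP <-; ring.
have : normc (a K.+1) * (D K.+1)%:R * (n - K.+1)%:R <= A * (D K.+1)%:R.
  rewrite -(@normc_nat R (D _)) -Normc.normcM top normcN normc_nat.
  apply: le_trans (ler_wpM2r (ler0n _ _) (normc_sum _ _ _)) _.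
  rewrite !mulr_suml !big_seq ler_sum // => i; rewrite mem_index_iota => iK.
  rewrite Normc.normcM normc_nat -mulrA ler_wpM2l ?normc_ge0 //.
  rewrite -natrM ler_nat /D.
  apply: (@leq_trans ((n - K) * (n ^_ K - m ^_ K))); last first.
    by apply: leq_ffactB; exact: ltnW.
  rewrite mulnC leq_mul //; first lia.
  by apply: leq_ffactB_mono; lia.
rewrite mulrAC ler_pM2r ?ltr0n // leNgt => /negP; apply.
rewrite mulrC -ltr_pdivrMr ?normc_gt0 //.
apply: (lt_le_trans (truncnS_gt _)); rewrite -/N ler_nat leq_subRL 1?addnC //.
exact: leq_trans (leq_addl _ _) Nn.
Qed.

(** * Eigenvalues and existence of eigenpolynomials *)

(** When deg Q_j <= j for all j, T is triangular in the monomial basis, and this is its diagonal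
    entry at z^n. *)
Definition es_eigenvalue (R : realType) (k : nat) (Q : nat -> {poly R[i]})
    (n : nat) : R[i] :=
  \sum_(1 <= j < k.+1) (Q j)`_j * (n ^_ j)%:R.

Lemma coef_mul_top (R : nzRingType) (p q : {poly R}) (a b : nat) :
  (size p <= a.+1)%N -> (size q <= b.+1)%N -> (p * q)`_(a + b) = p`_a * q`_b.
Proof.
move=> pa qb; rewrite coefM (bigD1 (inord a)) //= inordK; last by lia.
rewrite addKn big1 ?addr0 // => i ia.
have : (i : nat) != a.
  by apply: contra_neq ia => ia; apply: val_inj; rewrite /= inordK //; lia.
rewrite neq_ltn => /orP[ia'|ai].
  rewrite [q`__]nth_default ?mulr0 // (leq_trans qb) // ltn_subRL.
  by rewrite ltn_add2r.
by rewrite [p`__]nth_default ?mul0r // (leq_trans pa).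
Qed.

Lemma size_derivn_le (R : nzRingType) (p : {poly R}) (j : nat) :
  (size p^`(j) <= size p - j)%N.
Proof.
apply/leq_sizeP => i; rewrite leq_subLR => ji.
by rewrite coef_derivn nth_default ?mul0rn.
Qed.

Lemma diffop_linear (R : realType) (k : nat) (Q : nat -> {poly R[i]})
    (c : R[i]) (p q : {poly R[i]}) :
  diffop k Q (c *: p + q) = c *: diffop k Q p + diffop k Q q.
Proof.
rewrite /diffop scaler_sumr -big_split /=; apply: eq_bigr => j _.
by rewrite linearP mulrDr scalerAr.
Qed.

Lemma size_diffop (R : realType) (k : nat) (Q : nat -> {poly R[i]})
    (p : {poly R[i]}) :
  (forall j : nat, (1 <= j <= k)%N -> (size (Q j) <= j.+1)%N) ->
  (size (diffop k Q p) <= size p)%N.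
Proof.
move=> sQ; rewrite /diffop big_seq; apply: (leq_trans (size_sum _ _ _)).
apply/bigmax_leqP_seq => j; rewrite mem_index_iota ltnS => jk _.
have := sQ j jk; have := size_derivn_le p j => sp sq.
have [->|p0] := eqVneq (p^`(j)) 0; first by rewrite mulr0 size_poly0.
apply: leq_trans (size_polyMleq _ _) _.
have : (0 < size p^`(j))%N by rewrite size_poly_gt0.
set a := size (Q j) in sq *; set b := size p^`(j) in sp *.
set c := size p in sp *; lia.
Qed.

Lemma coef_diffop_top (R : realType) (k : nat) (Q : nat -> {poly R[i]})
    (p : {poly R[i]}) (n : nat) :
  (forall j : nat, (1 <= j <= k)%N -> (size (Q j) <= j.+1)%N) ->
  (size p <= n.+1)%N ->
  (diffop k Q p)`_n = es_eigenvalue k Q n * p`_n.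
Proof.
move=> sQ pn; rewrite coef_sum mulr_suml !big_seq; apply: eq_bigr => j.
rewrite mem_index_iota ltnS => jk.
have [jn|nj] := leqP j n; last first.
  (* For j > n both sides vanish: the falling factorial is 0 and so is p^(j). *)
  rewrite ffact_small // mulr0 mul0r.
  have -> : p^`(j) = 0.
    apply/eqP; rewrite -size_poly_leq0; apply: leq_trans (size_derivn_le _ _) _.
    by rewrite leqn0 subn_eq0 (leq_trans pn).
  by rewrite mulr0 coef0.
rewrite -[in LHS](subnKC jn) coef_mul_top ?sQ //; last first.
  by rewrite (leq_trans (size_derivn_le _ _)) // -subSn // leq_sub2r.
by rewrite coef_derivn subnKC // -mulrA mulr_natl.
Qed.

(** Back substitution in the triangular system T - lambda_n, whose diagonal entries below degree n
    are nonzero by the distinctness of the eigenvalues. *)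
Lemma diffop_sub_solvable (R : realType) (k : nat) (Q : nat -> {poly R[i]})
    (n m : nat) (q : {poly R[i]}) :
  (forall j : nat, (1 <= j <= k)%N -> (size (Q j) <= j.+1)%N) ->
  (forall i, (i < n)%N -> es_eigenvalue k Q i != es_eigenvalue k Q n) ->
  (m <= n)%N -> (size q <= m)%N ->
  exists2 u : {poly R[i]}, (size u <= m)%N &
    diffop k Q u - es_eigenvalue k Q n *: u = q.
Proof.
move=> sQ dist; elim: m q => [|m IH] q mn qm.
  exists 0; first by rewrite size_poly0.
  move: qm; rewrite size_poly_leq0 => /eqP ->.
  rewrite scaler0 subr0 /diffop big1 // => j _.
  by rewrite raddf0 mulr0.
have lm0 : es_eigenvalue k Q m - es_eigenvalue k Q n != 0.
  by rewrite subr_eq0 dist.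
(* Chosen so that subtracting (T - lambda_n)(c z^m) cancels the coefficient of z^m in [q]. *)
pose c := q`_m / (es_eigenvalue k Q m - es_eigenvalue k Q n).
have [||u um uq] := IH
  (q - c *: (diffop k Q 'X^m - es_eigenvalue k Q n *: 'X^m)).
- exact: ltnW.
- apply/leq_sizeP => j; rewrite leq_eqVlt => /orP[/eqP <-|mj].
    rewrite coefB coefZ coefB coefZ coef_diffop_top ?size_polyXn //.
    by rewrite coefXn eqxx !mulr1 /c divfK ?subrr.
  rewrite nth_default // (leq_trans _ mj) //.
  rewrite (leq_trans (size_polyD _ _)) // geq_max qm size_polyN.
  rewrite (leq_trans (size_scale_leq _ _)) //.
  rewrite (leq_trans (size_polyD _ _)) // geq_max size_polyN.
  rewrite (leq_trans (size_diffop _ sQ)) ?size_polyXn //=.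
  by rewrite (leq_trans (size_scale_leq _ _)) // size_polyXn.
exists (c *: 'X^m + u).
  rewrite (leq_trans (size_polyD _ _)) // geq_max (leq_trans um) // andbT.
  by rewrite (leq_trans (size_scale_leq _ _)) // size_polyXn.
rewrite diffop_linear scalerDr; move/eqP: uq; rewrite eq_sym subr_eq => /eqP ->.
by rewrite scalerBr !scalerA (mulrC c) opprD addrACA addrC.
Qed.

(** Take p = z^n + u with (T - lambda_n) u = -(T - lambda_n) z^n; the right side has degree below n
    because its top coefficient cancels. *)
Lemma monic_eigenpoly_exists (R : realType) (k : nat) (Q : nat -> {poly R[i]})
    (n : nat) :
  (forall j : nat, (1 <= j <= k)%N -> (size (Q j) <= j.+1)%N) ->
  (forall i, (i < n)%N -> es_eigenvalue k Q i != es_eigenvalue k Q n) ->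
  exists p, is_monic_eigenpoly k Q n p.
Proof.
move=> sQ dist.
have [||u un uq] := @diffop_sub_solvable R k Q n n
   (es_eigenvalue k Q n *: 'X^n - diffop k Q 'X^n) sQ dist.
- exact: leqnn.
- apply/leq_sizeP => j; rewrite leq_eqVlt => /orP[/eqP <-|mj].
    by rewrite coefB coefZ coef_diffop_top ?size_polyXn // subrr.
  rewrite nth_default // (leq_trans _ mj) //.
  rewrite (leq_trans (size_polyD _ _)) // geq_max size_polyN.
  rewrite (leq_trans (size_diffop _ sQ)) ?size_polyXn // andbT.
  by rewrite (leq_trans (size_scale_leq _ _)) // size_polyXn.
exists ('X^n + u); split.
- by rewrite monicE lead_coefDl ?lead_coefXn ?size_polyXn ?ltnS.
- by rewrite size_polyDl size_polyXn.
exists (es_eigenvalue k Q n).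
rewrite -[X in X + u]scale1r diffop_linear scale1r scalerDr.
move/eqP: uq; rewrite subr_eq => /eqP ->.
by rewrite scale1r addrA (addrC (diffop _ _ _)) subrK.
Qed.

(** Comparing coefficients of z^n forces the eigenvalue. *)
Lemma eigenpoly_diffop (R : realType) (k : nat) (Q : nat -> {poly R[i]})
    (n : nat) (p : {poly R[i]}) :
  (forall j : nat, (1 <= j <= k)%N -> (size (Q j) <= j.+1)%N) ->
  is_monic_eigenpoly k Q n p -> diffop k Q p = es_eigenvalue k Q n *: p.
Proof.
move=> sQ [pm sp [l lp]]; rewrite lp; congr (_ *: _).
have pn : p`_n = 1 by move/monicP: pm; rewrite lead_coefE sp.
have := coef_diffop_top sQ (eq_leq sp).
by rewrite lp coefZ pn !mulr1.
Qed.

(** * Bounds for root radii and for polynomials at real points x >= 1 *)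

Lemma leq_ffact_expn (n m : nat) : (n ^_ m <= n ^ m)%N.
Proof.
by elim: m => // m IH; rewrite ffactnSr expnSr leq_mul // leq_subr.
Qed.

Lemma root_le_radius (R : realType) (p : {poly R[i]}) (z : R[i]) :
  p != 0 -> root p z -> normc z <= root_radius p.
Proof.
move=> p0 pz; have [s ps] := closed_field_poly_normal p.
have fin : finite_set [set w : R[i] | root p w].
  apply: sub_finite_set (finite_seq s) => w /=.
  by rewrite ps rootZ ?lead_coef_eq0 // root_prod_XsubC.
by apply: order.Order.TotalTheory.le_bigmax_seq; rewrite // in_fset_set ?inE.
Qed.

Definition coef_norm (R : rcfType) (q : {poly R[i]}) : R :=
  \sum_(i < size q) normc q`_i.

Lemma coef_norm_ge0 (R : rcfType) (q : {poly R[i]}) : 0 <= coef_norm q.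
Proof. by apply: sumr_ge0 => i _; exact: normc_ge0. Qed.

Lemma normc_horner_le (R : realType) (q : {poly R[i]}) (x : R) : 1 <= x ->
  normc q.[x%:C] <= coef_norm q * x ^+ pdeg q.
Proof.
move=> x1; have x0 := le_trans ler01 x1.
rewrite horner_coef (le_trans (normc_sum _ _ _)) // mulr_suml ler_sum // => i _.
rewrite Normc.normcM normcX normc_real // ler_wpM2l ?normc_ge0 //.
by rewrite ler_weXn2l // -ltnS (ltn_predK (ltn_ord i)).
Qed.

Lemma normc_coef_le (R : realType) (q : {poly R[i]}) (x : R) (i : nat) :
  1 <= x -> normc q`_i * x ^+ i <= coef_norm q * x ^+ pdeg q.
Proof.
move=> x1; have x0 := le_trans ler01 x1.
have [iq|qi] := ltnP i (size q); last first.
  rewrite nth_default // Normc.normc0 mul0r mulr_ge0 ?exprn_ge0 //.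
  exact: coef_norm_ge0.
apply: ler_pM; rewrite ?exprn_ge0 ?normc_ge0 //.
  rewrite /coef_norm (bigD1 (Ordinal iq)) //= lerDl.
  by apply: sumr_ge0 => j _; exact: normc_ge0.
by rewrite ler_weXn2l // /pdeg; move: iq; case: (size q).
Qed.

(** The lower terms add up to at most [coef_norm q] times x^(deg q - 1), which the last hypothesis
    makes at most half the leading term; in degree 0 there are none. *)
Lemma normc_horner_ge (R : realType) (q : {poly R[i]}) (x : R) : q != 0 ->
  1 <= x -> 2 * coef_norm q / normc (lead_coef q) <= x ->
  normc (lead_coef q) / 2 * x ^+ pdeg q <= normc q.[x%:C].
Proof.
move=> q0 x1; have x0 := le_trans ler01 x1.
have l0 : 0 < normc (lead_coef q) by rewrite normc_gt0 // lead_coef_eq0.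
rewrite ler_pdivrMr // => lx.
have : normc (lead_coef q) * x ^+ pdeg q -
    \sum_(i < pdeg q) normc q`_i * x ^+ i <= normc q.[x%:C].
  rewrite horner_coef -(prednK (n := size q)) ?size_poly_gt0 // big_ord_recr /=.
  rewrite -/(pdeg q) -lead_coefE; set S : R[i] := \sum_(_ < _) _.
  have -> : normc (lead_coef q) * x ^+ pdeg q =
            normc ((S + lead_coef q * x%:C ^+ pdeg q) - S).
    by rewrite addrAC subrr add0r Normc.normcM normcX normc_real.
  rewrite lerBlDr (le_trans (le_normcD _ _)) // lerD2l normcN.
  rewrite (le_trans (normc_sum _ _ _)) // ler_sum // => i _.
  by rewrite Normc.normcM normcX normc_real.
apply: le_trans; rewrite lerBrDr -lerBrDl.
have -> : normc (lead_coef q) * x ^+ pdeg q -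
    normc (lead_coef q) / 2 * x ^+ pdeg q =
    normc (lead_coef q) / 2 * x ^+ pdeg q by field.
case E : (pdeg q) => [|d].
  by rewrite big_ord0 mulr_ge0 ?divr_ge0 ?ltW.
rewrite exprS mulrA.
apply: (@le_trans _ _ (coef_norm q * x ^+ d)); last first.
  by rewrite ler_wpM2r ?exprn_ge0 //; lra.
have sq : size q = d.+2.
  by rewrite -(prednK (n := size q)) ?size_poly_gt0 // -/(pdeg q) E.
rewrite /coef_norm sq mulr_suml [leRHS]big_ord_recr /= -[leLHS]addr0.
apply: lerD; last by rewrite mulr_ge0 ?normc_ge0 ?exprn_ge0.
apply: ler_sum => i _; rewrite ler_wpM2l ?normc_ge0 // ler_weXn2l //.
by rewrite -ltnS.
Qed.

(** * The estimate from the eigenvalue equation *)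

(** The factor 2 counts two contributions for each j, one from lambda_n p and one from Q_j p^(j);
    4^k bounds the powers of 4 coming from [derivn_horner_ge]. *)
Lemma lead_term_le (R : realType) (k : nat) (Q : nat -> {poly R[i]})
    (n : nat) (p : {poly R[i]}) (x : R) :
  degenerate_exactly_solvable k Q -> is_monic_eigenpoly k Q n p ->
  (k.*2 <= n)%N -> 1 <= x -> (forall w, root p w -> normc w < x) ->
  normc (Q k).[x%:C] <= \sum_(1 <= j < k)
     2 * 4 ^+ k * coef_norm (Q j) *
       (x ^+ (pdeg (Q j) + (k - j)) / n%:R ^+ (k - j)).
Proof.
move=> [Qk sQ [j0 j0k _] sQk] pn kn x1 px.
have k0 : (0 < k)%N by lia.
have [_ sp _] := pn; have Tp := eigenpoly_diffop sQ pn.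
have x0 : 0 < x by apply: lt_le_trans x1.
have nx : normc x%:C = x by rewrite normc_real // ltW.
have n0 : 0 < n%:R :> R by rewrite ltr0n; lia.
have G j := @derivn_horner_ge R p x%:C n k j sp kn.
rewrite nx in G.
have [pk0 _] := G k (leqnn k) x0 px.
have Gk0 : 0 < x ^+ k * normc p^`(k).[x%:C].
  by rewrite mulr_gt0 ?exprn_gt0 ?normc_gt0.
(* The equation T p = lambda_n p at x, solved for its top term. Degeneracy enters here: deg Q_k < k
   removes the summand j = k from lambda_n. *)
have key : (Q k).[x%:C] * p^`(k).[x%:C] = \sum_(1 <= j < k)
    ((Q j)`_j * (n ^_ j)%:R * p.[x%:C] - (Q j).[x%:C] * p^`(j).[x%:C]).
  have := congr1 (fun q => q.[x%:C]) Tp; rewrite /= /diffop /es_eigenvalue.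
  rewrite hornerZ horner_sum !(big_nat_recr k) //=.
  rewrite [(Q k)`_k]nth_default // mul0r addr0 hornerM => /eqP.
  rewrite eq_sym addrC -subr_eq => /eqP <-.
  rewrite sumrB -mulr_suml; congr (_ - _).
  by apply: eq_bigr => j _; rewrite hornerM.
rewrite -(ler_pM2r Gk0) mulrCA -Normc.normcM key.
apply: le_trans (ler_wpM2l (exprn_ge0 _ (ltW x0)) (normc_sum _ _ _)) _.
rewrite mulr_sumr mulr_suml !big_seq ler_sum // => j.
rewrite mem_index_iota => /andP[j1 jk].
have [_ Gj] := G j (ltnW jk) x0 px.
have [_ {G}] := G 0%N (leq0n k) x0 px.
rewrite subn0 mul1r derivn0 => G0.
set Gk := x ^+ k * _ in Gj G0 Gk0 *.
have xk : x ^+ k = x ^+ (k - j) * x ^+ j by rewrite -exprD subnK // ltnW.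
have nk : n%:R ^+ k = n%:R ^+ (k - j) * n%:R ^+ j :> R.
  by rewrite -exprD subnK // ltnW.
have fk : 4 ^+ (k - j) <= 4 ^+ k :> R by rewrite ler_weXn2l ?leq_subr // ler1n.
set C := coef_norm (Q j); set q := pdeg (Q j).
have C0 : 0 <= C by exact: coef_norm_ge0.
(* Contribution of lambda_n p: the falling factorial is at most n^j, and |p(x)| is controlled by
   [derivn_horner_ge] at index 0. *)
have T1 : x ^+ k * (normc (Q j)`_j * (n ^_ j)%:R * normc p.[x%:C]) <=
    4 ^+ k * C * (x ^+ (q + (k - j)) / n%:R ^+ (k - j)) * Gk.
  apply: (@le_trans _ _ (x ^+ (k - j) * (C * x ^+ q) *
    (n%:R ^+ j * normc p.[x%:C]))).
    rewrite xk -!mulrA ler_wpM2l ?exprn_ge0 ?(ltW x0) // !mulrA.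
    rewrite ler_wpM2r ?normc_ge0 // (mulrC (x ^+ j)) ler_pM //.
    - by rewrite mulr_ge0 ?normc_ge0 ?exprn_ge0 ?(ltW x0).
    - exact: normc_coef_le.
    by rewrite -natrX ler_nat leq_ffact_expn.
  apply: (@le_trans _ _ (4 ^+ k * C * (x ^+ (q + (k - j)) / n%:R ^+ (k - j)) *
    ((n%:R / 4) ^+ k * normc p.[x%:C]))); last first.
    apply: ler_wpM2l; last exact: G0.
    by rewrite !mulr_ge0 ?exprn_ge0 ?invr_ge0 ?exprn_ge0 ?(ltW x0).
  rewrite le_eqVlt; apply/orP; left; apply/eqP.
  rewrite expr_div_n nk exprD; field.
  by rewrite ?expf_neq0 ?lt0r_neq0.
(* Contribution of Q_j p^(j), controlled by [derivn_horner_ge] at index j. *)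
have T2 : x ^+ k * (normc (Q j).[x%:C] * normc p^`(j).[x%:C]) <=
    4 ^+ k * C * (x ^+ (q + (k - j)) / n%:R ^+ (k - j)) * Gk.
  apply: (@le_trans _ _ (x ^+ (k - j) * (C * x ^+ q) *
    (x ^+ j * normc p^`(j).[x%:C]))).
    rewrite xk -!mulrA ler_wpM2l ?exprn_ge0 ?(ltW x0) // mulrCA !mulrA.
    rewrite ler_wpM2r ?normc_ge0 // ler_wpM2r ?exprn_ge0 ?(ltW x0) //.
    exact: normc_horner_le.
  apply: (@le_trans _ _ (4 ^+ (k - j) * C *
    (x ^+ (q + (k - j)) / n%:R ^+ (k - j)) *
    ((n%:R / 4) ^+ (k - j) * (x ^+ j * normc p^`(j).[x%:C])))).
    rewrite le_eqVlt; apply/orP; left; apply/eqP.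
    rewrite expr_div_n exprD; field.
    by rewrite ?expf_neq0 ?lt0r_neq0.
  apply: ler_pM; rewrite ?mulr_ge0 ?exprn_ge0 ?invr_ge0 ?exprn_ge0 //;
    rewrite ?normc_ge0 ?(ltW x0) //.
  rewrite -!mulrA ler_wpM2r //.
  by rewrite !mulr_ge0 ?exprn_ge0 ?invr_ge0 ?exprn_ge0 ?(ltW x0).
apply: (@le_trans _ _ (x ^+ k * (normc (Q j)`_j * (n ^_ j)%:R * normc p.[x%:C])
   + x ^+ k * (normc (Q j).[x%:C] * normc p^`(j).[x%:C]))).
  rewrite -mulrDr ler_wpM2l ?exprn_ge0 ?(ltW x0) //.
  by rewrite (le_trans (le_normcD _ _)) // normcN !Normc.normcM normc_nat.
have -> : 2 * 4 ^+ k * C = 4 ^+ k * C + 4 ^+ k * C by ring.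
by rewrite !mulrDl lerD.
Qed.

(** * Choice of the exponent and asymptotics in n *)

Lemma powR_nat_ge (R : realType) (d M : R) : 0 < d ->
  \forall n \near \oo, M <= n%:R `^ d.
Proof.
move=> d0; near=> n.
have n1 : Num.max M 0 `^ d^-1 <= n%:R by near: n; exact: nbhs_infty_ger.
apply: (@le_trans _ _ (Num.max M 0)); first by rewrite le_max lexx.
have -> : Num.max M 0 = (Num.max M 0 `^ d^-1) `^ d.
  by rewrite -powRrM mulVf ?lt0r_neq0 // powRr1 // le_max lexx orbT.
by apply: ge0_ler_powR n1; rewrite ?nnegrE ?powR_ge0 // ltW.
Unshelve. all: by end_near. Qed.

(** Since c > 0, an index with nonpositive denominator satisfies the last inequality trivially; the
    others satisfy it because c < b. *)
Lemma exponent_between (R : realType) (k : nat) (Q : nat -> {poly R[i]})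
    (gamma : R) : (gamma%:E < min_exponent k Q)%E ->
  exists c : R, [/\ 0 < c, gamma < c &
    forall j, (1 <= j < k)%N -> Q j != 0 ->
      c * ((pdeg (Q j))%:R + (k - j)%:R - (pdeg (Q k))%:R) < (k - j)%:R].
Proof.
move=> hg.
(* Every quotient in the minimum is positive, so b > 0. *)
have : ((Num.max gamma 0)%:E < min_exponent k Q)%E.
  rewrite EFin_max comparable_gt_max ?hg /=; last first.
    by rewrite /Order.comparable le_total.
  rewrite /min_exponent big_seq_cond; apply: lt_bigmin; first exact: ltey.
  move=> j; rewrite mem_index_iota => /andP[/andP[_ jk] /andP[_ D0]].
  by rewrite lte_fin divr_gt0 ?ltr0z // subr_gt0 ltr_nat.
set b := min_exponent k Q => mb.
have [c mc cb] : exists2 c, Num.max gamma 0 < c & (c%:E <= b)%E.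
  case: b mb => [r| |]//; first by rewrite lte_fin; exists r.
  by exists (Num.max gamma 0 + 1); rewrite ?ltrDl // leey.
(* [c] may equal b; the midpoint restores strictness. *)
pose e := (Num.max gamma 0 + c) / 2.
have me : Num.max gamma 0 < e by rewrite midf_lt.
have ec : e < c by rewrite midf_lt.
have /andP[ge e0] : (gamma < e) && (0 < e).
  by move: me; rewrite gt_max.
exists e; split=> // j jk Qj.
have jk' : (j <= k)%N by lia.
have kj0 : 0 < (k - j)%:R :> R by rewrite ltr0n; lia.
have DE : (pdeg (Q j))%:R + (k - j)%:R - (pdeg (Q k))%:R =
    (min_denom k Q j)%:~R :> R.
  by rewrite /min_denom !rmorphD !rmorphN /= natrB // -!pmulrn; ring.
rewrite DE; have [D0|D0] := ltP 0 (min_denom k Q j); last first.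
  apply: le_lt_trans kj0; rewrite mulr_ge0_le0 ?(ltW e0) //.
  by rewrite lerz0.
rewrite -ltr_pdivlMr ?ltr0z //; apply: lt_le_trans ec _.
rewrite -lee_fin (le_trans cb) // natrB //.
apply: order.Order.TotalTheory.ge_bigmin_seq; last by rewrite Qj D0.
by rewrite mem_index_iota.
Qed.

(** Some alpha_{j,j} is nonzero by exact solvability, so [ffact_comb_inj] separates lambda_n from
    all earlier eigenvalues once n is large. *)
Lemma es_eigenpoly_exists (R : realType) (k : nat) (Q : nat -> {poly R[i]}) :
  degenerate_exactly_solvable k Q ->
  \forall n \near \oo, is_monic_eigenpoly k Q n (es_eigenpoly k Q n).
Proof.
move=> [Qk sQ [j jk sj] _].
have [|N HN] := @ffact_comb_inj R (fun j => (Q j)`_j) k.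
  exists j => //; have -> : (Q j)`_j = lead_coef (Q j) by rewrite lead_coefE sj.
  by rewrite lead_coef_eq0 -size_poly_gt0 sj.
near=> n; apply: xgetPex; apply: monic_eigenpoly_exists => // i ni.
by apply: HN => //; near: n; exact: nbhs_infty_ge.
Unshelve. all: by end_near. Qed.

Lemma root_radius_ge_powR (R : realType) (k : nat) (Q : nat -> {poly R[i]})
    (c : R) :
  degenerate_exactly_solvable k Q -> 0 < c ->
  (forall j, (1 <= j < k)%N -> Q j != 0 ->
      c * ((pdeg (Q j))%:R + (k - j)%:R - (pdeg (Q k))%:R) < (k - j)%:R) ->
  \forall n \near \oo, n%:R `^ c <= root_radius (es_eigenpoly k Q n).
Proof.
move=> hT c0 hc; have [Qk _ _ _] := hT.
pose l := normc (lead_coef (Q k)).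
have l0 : 0 < l by rewrite normc_gt0 // lead_coef_eq0.
pose A j := 2 * 4 ^+ k * coef_norm (Q j).
have A0 j : 0 <= A j by rewrite !mulr_ge0 ?exprn_ge0 ?coef_norm_ge0.
(* The exponent gap: at x = n^c, x^(deg Q_j + k - j) n^(-(k-j)) equals x^(deg Q_k) n^(-d j). *)
pose d j := (k - j)%:R - c * ((pdeg (Q j))%:R + (k - j)%:R - (pdeg (Q k))%:R).
(* With fewer than k + 1 summands, each at most eps x^(deg Q_k), the sum stays below the lower bound
   (l/2) x^(deg Q_k) for |Q_k(x)|. *)
pose eps := l / 2 / k.+1%:R.
have eps0 : 0 < eps by rewrite !divr_gt0.
(* Indexing by the finite type ['I_k] gives one threshold in n for all j. *)
have small : \forall n \near \oo, forall j : 'I_k, (0 < j)%N ->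
    A j <= eps * n%:R `^ d j.
  apply: filter_forall => j; case: (posnP j) => [->|j0]; first by near=> n.
  have [Qj|Qj] := eqVneq (Q j) 0.
    near=> n => _; rewrite /A Qj /coef_norm size_poly0 big_ord0 mulr0.
    by rewrite mulr_ge0 ?powR_ge0 ?ltW.
  near=> n => _; rewrite mulrC -ler_pdivrMr //; near: n; apply: powR_nat_ge.
  by rewrite subr_gt0 hc // j0 ltn_ord.
near=> n; rewrite leNgt; apply/negP => rx.
set x := n%:R `^ c in rx.
have n1 : (0 < n)%N by near: n; exact: nbhs_infty_gt.
have n0 : 0 < n%:R :> R by rewrite ltr0n.
have x1 : 1 <= n%:R `^ c by near: n; exact: powR_nat_ge.
have x0 : 0 < x by exact: lt_le_trans x1.
have pn : is_monic_eigenpoly k Q n (es_eigenpoly k Q n).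
  by near: n; exact: es_eigenpoly_exists.
have p0 : es_eigenpoly k Q n != 0 by case: pn => /monic_neq0.
have kn : (k.*2 <= n)%N by near: n; exact: nbhs_infty_ge.
have xX : 2 * coef_norm (Q k) / l <= n%:R `^ c by near: n; exact: powR_nat_ge.
have px w : root (es_eigenpoly k Q n) w -> normc w < x.
  by move=> /(root_le_radius p0) /le_lt_trans; exact.
have := lead_term_le hT pn kn x1 px; rewrite leNgt => /negP; apply.
apply: (lt_le_trans _ (normc_horner_ge Qk x1 xX)).
apply: (@le_lt_trans _ _ (\sum_(1 <= j < k) eps * x ^+ pdeg (Q k))).
  rewrite !big_seq ler_sum // => j; rewrite mem_index_iota => /andP[j1 jk].
  have Aj : A j <= eps * n%:R `^ d j.
    by move: j1; apply: (near small n _ (Ordinal jk)).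
  apply: (le_trans (ler_wpM2r _ Aj)).
    by rewrite mulr_ge0 ?invr_ge0 ?exprn_ge0 // ltW.
  rewrite -mulrA ler_wpM2l ?(ltW eps0) //.
  rewrite -!powR_mulrn ?(ltW x0) ?(ltW n0) // -!powRrM -powRN -!powRD.
  - rewrite natrD le_eqVlt; apply/orP; left; apply/eqP.
    by congr (_ `^ _); rewrite /d; ring.
  - by rewrite (gt_eqF n0) implybT.
  - by rewrite (gt_eqF n0) implybT.
rewrite sumr_const_nat -[ltLHS]mulr_natr -/x -/l (mulrAC eps).
rewrite ltr_pM2r ?exprn_gt0 //.
rewrite /eps mulrAC ltr_pdivrMr ?ltr0n // ltr_pM2l ?divr_gt0 // ltr_nat.
by rewrite ltnS leq_subr.
Unshelve. all: by end_near. Qed.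
Theorem theorem2 (R : realType) (k : nat) (Q : nat -> {poly R[i]})
    (hT : degenerate_exactly_solvable k Q) (gamma : R)
    (hgamma : (gamma%:E < min_exponent k Q)%E) :
  root_radius (es_eigenpoly k Q n) / (n%:R `^ gamma) @[n --> \oo] --> +oo%R.
Proof.
have [c [c0 gc hc]] := exponent_between hgamma.
apply/cvgryPge => M; near=> n.
have n0 : 0 < n%:R :> R by rewrite ltr0n; near: n; exact: nbhs_infty_gt.
rewrite ler_pdivlMr ?powR_gt0 //.
apply: (@le_trans _ _ (n%:R `^ c)).
  (* Split n^c as n^(c - gamma) n^gamma; the first factor exceeds any M eventually. *)
  rewrite -[c](subrK gamma) powRD ?(gt_eqF n0) ?implybT //.
  rewrite ler_wpM2r ?powR_ge0 //; near: n; apply: powR_nat_ge.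
  by rewrite subr_gt0.
by near: n; exact: root_radius_ge_powR.
Unshelve. all: by end_near. Qed.
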